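(* Let $m = 2k$ with $k \ge 1$, let $n \ge 2$ and $1 \le r \le n$ be integers with $\gcd(m, r) = 1$, and let $\mathcal{A}$ be an $m$th order $n$ dimensional generalized anti-circulant tensor with circulant index $r$ and generating vector $\mathbf{v} = (v_0, \dots, v_{(n-1)m})^\top$. Then $\mathcal{A}$ is PSD if and only if $v_0 = v_1 = \cdots = v_{r-1} \ge 0$. In this case, $$f(\mathbf{x}) = v_0 (x_1 + \cdots + x_n)^m \quad \text{for all } \mathbf{x} \in \mathbb{R}^n,$$ and $$\mathbf{y}^\top A \mathbf{y} = v_0 \left(y_1 + \cdots + y_{nk-k+1}\right)^2 \quad \text{for all } \mathbf{y} \in \mathbb{R}^{nk-k+1},$$ where $f$ is the Hankel polynomial of $\mathcal{A}$ and $A$ is the associated Hankel matrix; consequently $\mathcal{A}$ is a strong Hankel tensor and hence an SOS Hankel tensor.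
   Context: Let $m, n \ge 2$ and $\mathbf{v} = (v_0, \dots, v_{(n-1)m})^\top \in \mathbb{R}^{(n-1)m+1}$. The $m$th order $n$ dimensional Hankel tensor with generating vector $\mathbf{v}$ is $\mathcal{A} = (a_{i_1 \cdots i_m})$ with $a_{i_1\cdots i_m} = v_{i_1 + \cdots + i_m - m}$ for $i_1, \dots, i_m = 1, \dots, n$. Given $1 \le r \le n$, $\mathcal{A}$ is called a generalized anti-circulant tensor with circulant index $r$ if $v_i = v_{i+r}$ for all $i = 0, \dots, (n-1)m - r$. The Hankel polynomial of $\mathcal{A}$ is $f(\mathbf{x}) = \sum_{i_1, \dots, i_m = 1}^n v_{i_1 + \cdots + i_m - m}\, x_{i_1} \cdots x_{i_m}$ for $\mathbf{x} = (x_1, \dots, x_n)^\top \in \mathbb{R}^n$. Let $m = 2k$ be even. $\mathcal{A}$ is PSD (positive semi-definite) if $f(\mathbf{x}) \ge 0$ for all $\mathbf{x} \in \mathbb{R}^n$. $\mathcal{A}$ is an SOS Hankel tensor if $f$ is a sum of squares of polynomials of degree $k$. The associated Hankel matrix is the $(nk-k+1)\times(nk-k+1)$ matrix $A = (a_{ij})$ with $a_{ij} = v_{i+j-2}$ for $i, j = 1, \dots, nk-k+1$. $\mathcal{A}$ is a strong Hankel tensor if $A$ is positive semi-definite. *)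

(* Defs.v *)
From mathcomp Require Import all_boot all_order all_algebra.
From mathcomp Require Import reals.
From mathcomp Require Import mpoly.

Set Implicit Arguments.
Unset Strict Implicit.
Unset Printing Implicit Defensive.

Import GRing.Theory Num.Theory.
Local Open Scope ring_scope.

(* Indices are 0-based throughout: the 1-based index i_1 + ... + i_m - m
   becomes the plain sum of the 0-based indices. *)

Definition tensor (R : Type) (m n : nat) := {ffun 'I_m -> 'I_n} -> R.

Lemma hankel_index_subproof (m n : nat) (i : {ffun 'I_m -> 'I_n}) :
  (\sum_(j < m) i j < ((n - 1) * m).+1)%N.
Proof.
rewrite ltnS mulnC -[X in (_ <= X * _)%N]card_ord -sum_nat_const.
by apply: leq_sum => j _; case: n i => [|n] i; [case: (i j)|
  rewrite subn1 -ltnS ltn_ord].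
Qed.

Definition hankel_index (m n : nat) (i : {ffun 'I_m -> 'I_n}) :
  'I_((n - 1) * m).+1 := Ordinal (hankel_index_subproof i).

Definition hankel_tensor (R : Type) (m n : nat)
    (v : 'cV[R]_((n - 1) * m).+1) : tensor R m n :=
  fun i => v (hankel_index i) 0.

Definition generalized_anti_circulant (R : Type) (m n r : nat)
    (v : 'cV[R]_((n - 1) * m).+1) : Prop :=
  forall i j : 'I_((n - 1) * m).+1, j = (i + r)%N :> nat -> v i 0 = v j 0.

Definition tensor_poly (R : realType) (m n : nat) (a : tensor R m n) :
    {mpoly R[n]} :=
  \sum_(i : {ffun 'I_m -> 'I_n}) a i *: \prod_(j < m) 'X_(i j).

Definition evalp (R : realType) (n : nat) (p : {mpoly R[n]}) (x : 'cV[R]_n) :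
  R := p.@[fun i => x i 0].

Definition psd_tensor (R : realType) (m n : nat) (a : tensor R m n) : Prop :=
  forall x : 'cV[R]_n, 0 <= evalp (tensor_poly a) x.

(* [msize p = k.+1] says that p has degree exactly k.  The list may be empty,
   so that the zero tensor is SOS. *)
Definition sos_tensor (R : realType) (k n : nat) (a : tensor R (2 * k) n) :
    Prop :=
  exists s : seq {mpoly R[n]},
    (forall p, p \in s -> msize p = k.+1) /\
    tensor_poly a = \sum_(p <- s) p ^+ 2.

Lemma hankel_mx_index_subproof (k n : nat) (i j : 'I_(n * k - k).+1) :
  (i + j < ((n - 1) * (2 * k)).+1)%N.
Proof.
rewrite ltnS mulnCA mulnBl mul1n mul2n -addnn.
by apply: leq_add; rewrite -ltnS ltn_ord.
Qed.

Definition hankel_mx_index (k n : nat) (i j : 'I_(n * k - k).+1) :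
  'I_((n - 1) * (2 * k)).+1 := Ordinal (hankel_mx_index_subproof i j).

Definition hankel_mx (R : Type) (k n : nat)
    (v : 'cV[R]_((n - 1) * (2 * k)).+1) : 'M[R]_((n * k - k).+1) :=
  \matrix_(i, j) v (hankel_mx_index i j) 0.

Definition quad_form (R : realType) (N : nat) (A : 'M[R]_N) (y : 'cV[R]_N) :
  R := (y^T *m A *m y) 0 0.

Definition psd_mx (R : realType) (N : nat) (A : 'M[R]_N) : Prop :=
  A^T = A /\ forall y : 'cV[R]_N, 0 <= quad_form A y.

Definition strong_hankel (R : realType) (k n : nat)
    (v : 'cV[R]_((n - 1) * (2 * k)).+1) : Prop :=
  psd_mx (hankel_mx v).

(* Main.v *)
Require Import Defs.
From HB Require Import structures.
From mathcomp Require Import all_boot all_order all_algebra.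
From mathcomp Require Import ring.
From mathcomp Require Import reals.
From mathcomp Require Import mpoly.

Set Implicit Arguments.
Unset Strict Implicit.
Unset Printing Implicit Defensive.

Import Order.TTheory GRing.Theory Num.Theory.
Local Open Scope ring_scope.

(** Write [m = 2 * k] for the order of the tensor.  A vector [x] is read as the
    polynomial [p = \sum_i x_i X^i]; expanding [p ^+ m] shows that the Hankel
    polynomial is [f x = L (p ^+ m)], where [L] is a linear functional with
    [L 'X^i = v_i].  Periodicity of [v] lets [L] be chosen to vanish on the
    ideal generated by ['X^r - 1] ([periodic_functional],
    [evalp_hankel_functional]).  Since [r <= n], every polynomial is congruent
    modulo ['X^r - 1] to one that comes from a vector, so the tensor being PSD
    means [0 <= L (p ^+ m)] for all polynomials [p].

    The remaining argument is about [L] alone.  As [m] is invertible modulo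
    [r], the exponents [m * t] with [t < r] run over all residues modulo [r],
    hence [('X - 1) * \sum_(t < r) 'X^(m * t)] is divisible by ['X^r - 1]
    ([dvdp_sum_Xn_coprime]).  Therefore the numbers
    [L (('X^t * ('X - 1) * q) ^+ m)], for [t < r], have sum zero; being
    nonnegative, they all vanish, so [L ((('X - 1) * q) ^+ m) = 0] for all [q].
    Taking [q = 1 + t w] and extracting the coefficient of [t] yields
    [L (('X - 1) ^+ m * w) = 0] for all [w].  Finally ['X^r - 1] has 1 as a
    simple root, so ['X - 1] lies in the ideal generated by ['X^r - 1] and
    [('X - 1) ^+ m], and [L (('X - 1) * w) = 0] for all [w]
    ([functional_vanish_Xsub1]).  With [w = 'X^i] this says
    [v_(i+1) = v_i]: the generating vector is constant.

    For a constant generating vector [c] the Hankel polynomial is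
    [c (X_1 + ... + X_n) ^ m] and the Hankel matrix has all its entries equal
    to [c], from which the other claims follow; the sum of squares is the
    single square of [sqrt c (X_1 + ... + X_n) ^ k]. *)

(** * Polynomials modulo 'X^r - 1 *)

Lemma dvdp_Xn_sub_1 (F : fieldType) (d e : nat) :
  (d %| e)%N -> 'X^d - 1 %| ('X^e - 1 : {poly F}).
Proof.
by move=> /dvdnP[q ->]; rewrite mulnC exprM [X in _ %| X]subrX1 dvdp_mulIl.
Qed.

(** In the quotient ring the sum is fixed by multiplication by ['X^m], because
    [('X^m) ^+ r = 1] there.  With [a * m = b * r + 1], multiplication by ['X]
    is the [a]-th iterate of multiplication by ['X^m], so it fixes the sum
    too. *)
Lemma dvdp_sum_Xn_coprime (F : fieldType) (m r : nat) : (0 < m)%N ->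
  coprime m r ->
  'X^r - 1 %| ('X - 1) * (\sum_(t < r) 'X^m ^+ t : {poly F}).
Proof.
move=> m_gt0 /eqP cop; set S := \sum_(t < r) _.
have dvdm : 'X^r - 1 %| ('X^m - 1) * S.
  by rewrite /S -subrX1 -exprM dvdp_Xn_sub_1 ?dvdn_mull.
case: (egcdnP r m_gt0) => a b; rewrite cop => eab _.
have -> : ('X - 1) * S = ('X^(a * m) - 1) * S - 'X * ('X^(b * r) - 1) * S.
  by rewrite eab addn1 exprS; ring.
apply: dvdp_sub.
  apply: dvdp_trans dvdm (dvdp_mul _ (dvdpp S)).
  exact/dvdp_Xn_sub_1/dvdn_mull.
by apply: dvdp_mulr; apply: dvdp_mull; apply: dvdp_Xn_sub_1; apply: dvdn_mull.
Qed.

(** A nonzero polynomial would have the infinitely many natural numbers among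
    its roots. *)
Lemma poly_eq0_of_horner (F : numDomainType) (p : {poly F}) :
  (forall t, p.[t] = 0) -> p = 0.
Proof.
move=> p0; apply: (@roots_geq_poly_eq0 _ _ [seq j%:R | j <- iota 0 (size p)]).
- by apply/allP => x _; apply/rootP.
- rewrite map_inj_in_uniq ?iota_uniq // => i j _ _ /eqP.
  by rewrite eqr_nat => /eqP.
- by rewrite size_map size_iota.
Qed.

(** * Functionals that are nonnegative on m-th powers *)

Section PositiveOnPowers.

Variables (R : realFieldType) (m r : nat) (L : {scalar {poly R}}).
Hypotheses (m_gt0 : (0 < m)%N) (r_gt0 : (0 < r)%N) (cop : coprime m r).
Hypothesis L0 : forall p, 'X^r - 1 %| p -> L p = 0.
Hypothesis L_ge0 : forall p : {poly R}, (size p <= r)%N -> 0 <= L (p ^+ m).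

(** Reducing [p] modulo ['X^r - 1] changes [p ^+ m] by an element of the ideal
    on which [L] vanishes. *)
Lemma functional_exp_ge0 p : 0 <= L (p ^+ m).
Proof.
have szD : size ('X^r - 1 : {poly R}) = r.+1 by rewrite size_Xn_sub_1.
have D0 : 'X^r - 1 != 0 :> {poly R} by rewrite -size_poly_eq0 szD.
set q := p %% ('X^r - 1).
have -> : L (p ^+ m) = L (q ^+ m).
  apply/eqP; rewrite -subr_eq0 -raddfB; apply/eqP/L0.
  rewrite subrXX dvdp_mulr // /q {1}(divp_eq p ('X^r - 1)) addrK.
  exact: dvdp_mulIr.
by apply: L_ge0; rewrite -ltnS -szD ltn_modp.
Qed.

(** Multiplying the base by ['X^t] keeps the value nonnegative, while the sum
    of the values over [t < r] is [L] of a multiple of ['X^r - 1].  Each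
    summand is thus zero, in particular the one for [t = 0]. *)
Lemma functional_vanish_exp q : L ((('X - 1) * q) ^+ m) = 0.
Proof.
have ge0 (t : 'I_r) : 0 <= L ('X^m ^+ t * (('X - 1) * q) ^+ m).
  by rewrite exprAC -exprMn functional_exp_ge0.
have /psumr_eq0P sum0 : \sum_(t < r) L ('X^m ^+ t * (('X - 1) * q) ^+ m) = 0.
  rewrite -raddf_sum -mulr_suml; apply: L0.
  rewrite -[X in _ * _ ^+ X](prednK m_gt0) exprS mulrA mulrA.
  rewrite [_ * ('X - 1)]mulrC.
  by do 2!apply: dvdp_mulr; apply: dvdp_sum_Xn_coprime.
have := sum0 (fun t _ => ge0 t) (Ordinal r_gt0) isT.
by rewrite expr0 mul1r.
Qed.

(** Polarization: [L ((('X - 1) * (1 + t w)) ^+ m)] is a polynomial in [t] that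
    vanishes everywhere, and its coefficient of degree 1 is [m] times the value
    in question. *)
Lemma functional_vanish_Xsub1_exp w : L (('X - 1) ^+ m * w) = 0.
Proof.
have LC c (q : {poly R}) : L (c%:P * q) = c * L q.
  by rewrite mul_polyC; exact: linearZ.
pose p : {poly R} :=
  \poly_(i < m.+1) (L (('X - 1) ^+ m * w ^+ i) *+ 'C(m, i)).
have /polyP/(_ 1%N) : p = 0.
  apply: poly_eq0_of_horner => t.
  rewrite -(functional_vanish_exp (1 + t%:P * w)).
  rewrite exprMn [(1 + _) ^+ m]exprDn mulr_sumr raddf_sum horner_poly.
  apply: eq_bigr => i _.
  by rewrite expr1n mul1r exprMn mulrnAr raddfMn mulrCA -polyC_exp /= LC mulrnAl
    mulrC.
rewrite coef_poly coef0 ltnS m_gt0 expr1 bin1 => /eqP.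
by rewrite mulrn_eq0 eqn0Ngt m_gt0 => /eqP.
Qed.

(** Write ['X^r - 1 = ('X - 1) * Phi].  The value of [Phi] at 1 is [r], which is
    nonzero, so [Phi] is coprime to [('X - 1) ^+ m]; multiplying a Bezout
    relation by [('X - 1) * w] splits it into two terms that [L] kills. *)
Lemma functional_vanish_Xsub1 w : L (('X - 1) * w) = 0.
Proof.
set Phi : {poly R} := \sum_(i < r) 'X^i.
have DE : 'X^r - 1 = ('X - 1) * Phi by rewrite subrX1.
have : coprimep Phi (('X - 1) ^+ m).
  rewrite coprimep_expr // -polyC1 coprimep_XsubC rootE horner_sum.
  under eq_bigr do rewrite hornerXn expr1n.
  by rewrite sumr_const card_ord pnatr_eq0 -lt0n.
case/Bezout_eq1_coprimepP => [[u z] /= uz].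
have -> : ('X - 1) * w =
    ('X^r - 1) * (u * w) + ('X - 1) ^+ m * (z * ('X - 1) * w).
  by rewrite DE -[LHS]mul1r -{1}uz; ring.
by rewrite raddfD /= functional_vanish_Xsub1_exp L0 ?dvdp_mulIl // addr0.
Qed.

End PositiveOnPowers.

(** * The functional of a periodic sequence *)

Section PeriodicFunctional.

Variables (F : fieldType) (r : nat) (g : nat -> F).

(** The linear functional that sends ['X^i] to the value of the [r]-periodic
    extension of [g 0, ..., g r.-1].  Going through the remainder makes both
    linearity and the vanishing on multiples of ['X^r - 1] immediate. *)
Definition periodic_functional (p : {poly F}) : F :=
  \sum_(i < r) (p %% ('X^r - 1))`_i * g i.

Fact periodic_functional_is_scalar : scalar periodic_functional.
Proof.
move=> c p q; rewrite /periodic_functional modpD modpZl mulr_sumr -big_split.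
by apply: eq_bigr => i _; rewrite coefD coefZ mulrDl mulrA.
Qed.

HB.instance Definition _ := GRing.isLinear.Build F {poly F} F *%R
  periodic_functional periodic_functional_is_scalar.

Lemma periodic_functional_eq0 p :
  'X^r - 1 %| p -> periodic_functional p = 0.
Proof.
move=> /modp_eq0P p0; rewrite /periodic_functional p0.
by apply: big1 => i _; rewrite coef0 mul0r.
Qed.

(** The sequence is only required to be periodic up to the index [N], since the
    generating vector of a tensor is finite. *)
Lemma periodic_functional_Xn N : (0 < r)%N ->
  (forall i, (i + r <= N)%N -> g (i + r)%N = g i) ->
  forall i, (i <= N)%N -> periodic_functional 'X^i = g i.
Proof.
move=> r_gt0 per; elim/ltn_ind => i IH iN; case: (ltnP i r) => [ir|ri].
  rewrite /periodic_functional modp_small ?size_Xn_sub_1 ?size_polyXn //.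
  rewrite (bigD1 (Ordinal ir)) //= coefXn eqxx mul1r big1 ?addr0 // => j.
  by rewrite coefXn -val_eqE /= => /negPf->; rewrite mul0r.
have iE : ((i - r) + r)%N = i by rewrite subnK.
have gE : g i = g (i - r)%N by rewrite -{1}iE per ?iE.
have lt_ir : (i - r < i)%N by rewrite -{2}iE -[X in (X < _)%N]addn0 ltn_add2l.
rewrite gE -(IH _ lt_ir (leq_trans (leq_subr _ _) iN)).
apply/eqP; rewrite -subr_eq0 -{1}iE -raddfB; apply/eqP.
apply: periodic_functional_eq0; rewrite exprD -{2}['X^(i - r)]mulr1 -mulrBr.
exact: dvdp_mulIr.
Qed.

End PeriodicFunctional.

(** * Hankel tensors *)

Lemma evalp_hankel (R : realType) (m n : nat) (v : 'cV[R]_((n - 1) * m).+1)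
    (x : 'cV[R]_n) :
  evalp (tensor_poly (hankel_tensor v)) x =
  \sum_(i : {ffun 'I_m -> 'I_n})
     v (hankel_index i) 0 * \prod_(j < m) x (i j) 0.
Proof.
rewrite /evalp /tensor_poly raddf_sum; apply: eq_bigr => i _.
rewrite /= mevalZ rmorph_prod; congr (_ * _); apply: eq_bigr => j _.
exact: mevalXU.
Qed.

(** The terms of the expanded power are indexed by the same functions
    ['I_m -> 'I_n] as the entries of the tensor, and the exponents add up to
    the Hankel index. *)
Lemma evalp_hankel_functional (R : realType) (m n : nat)
    (v : 'cV[R]_((n - 1) * m).+1) (L : {scalar {poly R}}) (x : 'cV[R]_n) :
  (forall i : 'I_((n - 1) * m).+1, L 'X^i = v i 0) ->
  evalp (tensor_poly (hankel_tensor v)) x =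
  L ((\sum_(i < n) (x i 0)%:P * 'X^i) ^+ m).
Proof.
move=> LX; rewrite evalp_hankel -[X in _ ^+ X]card_ord -prodr_const.
rewrite bigA_distr_bigA raddf_sum; apply: eq_bigr => i _ /=.
rewrite big_split -rmorph_prod -expr_sum /= mul_polyC.
by rewrite linearZ /= -LX mulrC.
Qed.

Lemma tensor_poly_hankel_const (R : realType) (m n : nat)
    (v : 'cV[R]_((n - 1) * m).+1) (c : R) : (forall i, v i 0 = c) ->
  tensor_poly (hankel_tensor v) = c *: (\sum_(i < n) 'X_i) ^+ m.
Proof.
move=> vc; rewrite -[X in _ ^+ X]card_ord -prodr_const bigA_distr_bigA.
by rewrite scaler_sumr; apply: eq_bigr => i _; rewrite /hankel_tensor vc.
Qed.

Lemma quad_form_const (R : realType) (N : nat) (A : 'M[R]_N) (c : R)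
    (y : 'cV[R]_N) : (forall i j, A i j = c) ->
  quad_form A y = c * (\sum_i y i 0) ^+ 2.
Proof.
move=> Ac; rewrite /quad_form mxE expr2 mulrA mulr_sumr; apply: eq_bigr => j _.
congr (_ * _); rewrite mxE mulr_sumr; apply: eq_bigr => i _.
by rewrite Ac mxE mulrC.
Qed.

(** A nonzero homogeneous polynomial of degree [k] has size [k.+1]. *)
Lemma msize_sum_var_exp (R : idomainType) (n k : nat) : (0 < n)%N ->
  msize ((\sum_(i < n) 'X_i) ^+ k : {mpoly R[n]}) = k.+1.
Proof.
move=> n_gt0; set s := \sum_(i < n) _.
have s_neq0 : s != 0.
  apply/eqP => /(congr1 (fun p : {mpoly R[n]} => p@_U_(Ordinal n_gt0))).
  rewrite /s mcoeff0 raddf_sum (bigD1 (Ordinal n_gt0)) //= mcoeffXU eqxx big1.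
    by move/eqP; rewrite addr0 oner_eq0.
  by move=> i /negPf i0; rewrite mcoeffXU i0.
have s_hom : s \is 1.-homog.
  by apply: rpred_sum => i _; rewrite dhomogX; apply/eqP/mdeg1.
have sk_neq0 : s ^+ k != 0 by rewrite expf_neq0.
have sk_hom : s ^+ k \is k.-homog by rewrite -[X in X.-homog]mul1n dhomogMn.
have kE := dhomog_uniq sk_neq0 sk_hom (dhomog_msize sk_hom).
by rewrite [in RHS]kE prednK // lt0n mmeasure_poly_eq0.
Qed.

Lemma anti_circulant_const (R : Type) (m n r : nat)
    (v : 'M[R]_(((n - 1) * m).+1, 1)) (c : R) : (0 < r)%N ->
  generalized_anti_circulant r v ->
  (forall i : 'I_((n - 1) * m).+1, (i < r)%N -> v i 0 = c) ->
  forall i, v i 0 = c.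
Proof.
move=> r_gt0 hv vc [i]; elim/ltn_ind: i => i IH ltiN.
case: (ltnP i r) => [ltir|leri]; first exact: vc.
have lt_ir : (i - r < i)%N by rewrite ltn_subrL r_gt0 (leq_trans r_gt0).
rewrite -(IH _ lt_ir (ltn_trans lt_ir ltiN)); symmetry; apply: hv.
by rewrite /= subnK.
Qed.

(** The link between tensors and functionals: the vectors of [R^n] supply all
    the polynomials of size at most [r] because [r <= n], so a PSD
    tensor gives a functional that is nonnegative on their [m]-th powers. *)
Lemma psd_anti_circulant_const (R : realType) (m n r : nat)
    (v : 'cV[R]_((n - 1) * m).+1) :
  (0 < m)%N -> (0 < r <= n)%N -> coprime m r ->
  generalized_anti_circulant r v -> psd_tensor (hankel_tensor v) ->
  forall i, v i 0 = v ord0 0.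
Proof.
move=> m_gt0 /andP[r_gt0 le_rn] cop hv psd.
set N := ((n - 1) * m)%N in v hv psd *.
pose g i := v (inord i) 0.
have LX (i : 'I_N.+1) : periodic_functional r g 'X^i = v i 0.
  rewrite (@periodic_functional_Xn _ _ _ N) //.
  - by rewrite /g inord_val.
  - move=> j jr; rewrite /g; symmetry; apply: hv.
    by rewrite !inordK // ltnS (leq_trans (leq_addr _ _) jr).
  - by rewrite -ltnS.
have L_ge0 (p : {poly R}) : (size p <= r)%N ->
    0 <= periodic_functional r g (p ^+ m).
  move=> szp; have := psd (\col_i p`_i); rewrite (evalp_hankel_functional _ LX).
  congr (0 <= periodic_functional r g (_ ^+ m)).
  rewrite -[RHS](coefK p) poly_def (big_ord_widen n (fun i => p`_i *: 'X^i)).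
    rewrite [RHS]big_mkcond; apply: eq_bigr => i _; rewrite mxE mul_polyC.
    by case: ltnP => // /(nth_default 0)->; rewrite scale0r.
  exact: leq_trans szp le_rn.
(* [w = 'X^i] in the vanishing property of [L] gives [L 'X^i.+1 = L 'X^i]. *)
have shift := functional_vanish_Xsub1 m_gt0 r_gt0 cop
  (@periodic_functional_eq0 _ _ g) L_ge0.
have step i : periodic_functional r g 'X^i = periodic_functional r g 1.
  elim: i => [|i <-]; first by rewrite expr0.
  apply/eqP; rewrite -subr_eq0 -raddfB exprS -{2}['X^i]mul1r -mulrBl.
  exact/eqP/shift.
by move=> i; rewrite -LX step -(step 0%N) -[RHS]LX.
Qed.

Theorem theorem2 (R : realType) (k n r : nat)
    (hk : (1 <= k)%N) (hn : (2 <= n)%N) (hr : (1 <= r <= n)%N)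
    (hcop : coprime (2 * k) r)
    (v : 'cV[R]_((n - 1) * (2 * k)).+1)
    (hv : generalized_anti_circulant r v) :
  (psd_tensor (hankel_tensor v) <->
     (forall i : 'I_((n - 1) * (2 * k)).+1, (i < r)%N -> v i 0 = v ord0 0) /\
     0 <= v ord0 0) /\
  (psd_tensor (hankel_tensor v) ->
     (forall x : 'cV[R]_n,
        evalp (tensor_poly (hankel_tensor v)) x =
        v ord0 0 * (\sum_i x i 0) ^+ (2 * k)) /\
     (forall y : 'cV[R]_(n * k - k).+1,
        quad_form (hankel_mx v) y = v ord0 0 * (\sum_i y i 0) ^+ 2) /\
     strong_hankel v /\
     sos_tensor (hankel_tensor v)).
Proof.
have r_gt0 : (0 < r)%N by case/andP: hr.
have n_gt0 : (0 < n)%N := ltnW hn.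
have psd_const : psd_tensor (hankel_tensor v) -> forall i, v i 0 = v ord0 0.
  by apply: (psd_anti_circulant_const (r := r)) => //; rewrite muln_gt0.
have evalE : (forall i, v i 0 = v ord0 0) -> forall x : 'cV[R]_n,
    evalp (tensor_poly (hankel_tensor v)) x =
    v ord0 0 * (\sum_i x i 0) ^+ (2 * k).
  move=> vc x; rewrite (tensor_poly_hankel_const vc) /evalp mevalZ.
  rewrite rmorphXn raddf_sum /=; congr (_ * _ ^+ _).
  by apply: eq_bigr => i _; rewrite mevalXU.
have psd_ge0 : psd_tensor (hankel_tensor v) -> 0 <= v ord0 0.
  (* A unit vector has coordinate sum 1, so [f] takes the value [v_0] there. *)
  move=> psd; have := psd (delta_mx (Ordinal n_gt0) 0).
  rewrite evalE; last exact: psd_const.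
  rewrite (bigD1 (Ordinal n_gt0)) //= mxE !eqxx big1 => [|i /negPf i0].
    by rewrite addr0 expr1n mulr1.
  by rewrite mxE i0.
split.
  split=> [psd | [vr v0]].
    by split=> [i _|]; [apply: psd_const | apply: psd_ge0].
  have vc := anti_circulant_const r_gt0 hv vr.
  move=> x; rewrite evalE // mulr_ge0 // exprn_even_ge0 //.
  by rewrite mul2n odd_double.
move=> psd; have vc := psd_const psd; have v0 := psd_ge0 psd.
have quadE (y : 'cV[R]_(n * k - k).+1) :
    quad_form (hankel_mx v) y = v ord0 0 * (\sum_i y i 0) ^+ 2.
  by apply: quad_form_const => i j; rewrite mxE vc.
split; first exact: evalE.
split; first exact: quadE.
split.
  split; first by apply/matrixP => i j; rewrite !mxE !vc.
  by move=> y; rewrite quadE mulr_ge0 // sqr_ge0.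
(* The summands must have degree exactly [k], which [0] has not: the zero tensor
   needs the empty sum. *)
have [c0|c_neq0] := eqVneq (v ord0 0) 0.
  exists [::]; split=> //.
  by rewrite (tensor_poly_hankel_const vc) c0 scale0r big_nil.
exists [:: Num.sqrt (v ord0 0) *: (\sum_(i < n) 'X_i) ^+ k]; split.
  move=> p; rewrite inE => /eqP->; rewrite msizeZ ?msize_sum_var_exp //.
  by rewrite sqrtr_eq0 -ltNge lt_neqAle eq_sym c_neq0.
rewrite (tensor_poly_hankel_const vc) big_seq1 exprZn sqr_sqrtr //.
by rewrite exprM exprAC.
Qed.
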